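(* The Dynamic NEM (D-NEM) pricing policy $\chi^*$, with payments $P_i^{\chi^*}(z_i)=\pi^*(g_{\mathcal N})\,z_i$, conforms with the cost-causation principle. That is, for every realization of the generation profile $(g_1,\dots,g_N)$: (1) (Uniform payment function) for all $i\ne j$ in $\mathcal N$, $z_i=z_j$ implies $P_i^{\chi^*}(z_i)=P_j^{\chi^*}(z_j)$; (2) (Monotonicity and cost-causation) the common payment function $P^{\chi^*}$ is monotonic (non-decreasing) and $P^{\chi^*}(0)=0$; (3) (Individual rationality) for every $i\in\mathcal N$, the surplus of member $i$ under D-NEM at its optimal consumption is no less than its maximal surplus as a standalone customer under the utility's NEM tariff: $$U_i(\bm d_i^{\psi^*})-\pi^*(g_{\mathcal N})\,z_i^{\psi^*}\ \ge\ \max_{\bm d_i\in\mathcal D_i}\big\{U_i(\bm d_i)-P^{\rm NEM}(\bm 1^\top\bm d_i-g_i)\big\};$$ (4) (Profit neutrality) when members consume optimally in response to D-NEM, $\displaystyle\sum_{i\in\mathcal N}P_i^{\chi^*}(z_i^{\psi^*})=P^{\rm NEM}\Big(\sum_{i\in\mathcal N}z_i^{\psi^*}\Big)$.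
   Context: Setting. $\mathcal N=\{1,\dots,N\}$ is a set of community members, $\mathcal K=\{1,\dots,K\}$ a set of devices. Member $i$ chooses a consumption bundle $\bm d_i=(d_{i1},\dots,d_{iK})\in\mathcal D_i=\{\bm d_i:\underline{\bm d}_i\preceq\bm d_i\preceq\overline{\bm d}_i\}\subseteq\mathbb R_+^K$ (elementwise finite bounds, $\mathcal D_i$ nonempty) and has renewable generation $g_i\ge 0$; net consumption is $z_i=\bm 1^\top\bm d_i-g_i$, and $g_{\mathcal N}=\sum_{i\in\mathcal N}g_i$. Utilities. $U_i(\bm d_i)=\sum_{k\in\mathcal K}U_{ik}(d_{ik})$, where each $U_{ik}$ is concave, non-decreasing and continuously differentiable; the marginal utility $L_{ik}=U_{ik}'$ is assumed invertible (strictly decreasing), with inverse $f_{ik}=L_{ik}^{-1}$ defined (with values in $\mathbb R_+$) at every price in $[\pi^-,\pi^+]$. Utility tariff. $P^{\rm NEM}(z)=\pi^+\max\{0,z\}-\pi^-\max\{0,-z\}$ with $0\le\pi^-\le\pi^+$. D-NEM. Let $f_{\mathcal N}(y)=\sum_{i\in\mathcal N}\sum_{k\in\mathcal K}\max\{\underline d_{ik},\min\{f_{ik}(y),\overline d_{ik}\}\}$. The D-NEM price is $\pi^*(g_{\mathcal N})=\pi^+$ if $g_{\mathcal N}<f_{\mathcal N}(\pi^+)$; $\pi^*(g_{\mathcal N})=\pi^z(g_{\mathcal N})$ if $g_{\mathcal N}\in[f_{\mathcal N}(\pi^+),f_{\mathcal N}(\pi^-)]$; $\pi^*(g_{\mathcal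 N})=\pi^-$ if $g_{\mathcal N}>f_{\mathcal N}(\pi^-)$. Here $\pi^z(g_{\mathcal N})$ is a solution $\mu\in[\pi^-,\pi^+]$ of $f_{\mathcal N}(\mu)=g_{\mathcal N}$. The members' optimal consumption in response to D-NEM is $d^{\psi^*}_{ik}=\max\{\underline d_{ik},\min\{f_{ik}(\pi^*(g_{\mathcal N})),\overline d_{ik}\}\}$ for $i\in\mathcal N$, $k\in\mathcal K$, with $z_i^{\psi^*}=\bm 1^\top\bm d_i^{\psi^*}-g_i$. *)

(* Defs.v *)
From HB Require Import structures.
From mathcomp Require Import all_boot all_order all_algebra.
From mathcomp Require Import all_classical all_reals all_analysis.

Set Implicit Arguments.
Unset Strict Implicit.
Unset Printing Implicit Defensive.

Import Order.TTheory GRing.Theory Num.Theory.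
Import numFieldNormedType.Exports.

Local Open Scope classical_set_scope.
Local Open Scope ring_scope.

(* Members are indexed by 'I_N, devices by 'I_K, and a
   consumption bundle is a row vector 'rV[R]_K. *)

Definition concave_on (R : realType) (D : set R) (u : R -> R) : Prop :=
  convex_function D (fun x => - u x).

(* l is the derivative of u as a function on the half-line R_+ : two-sided at
   interior points and one-sided at 0.  Values of u and l on negative arguments
   play no role. *)
Definition derivative_on_nonneg (R : realType) (u l : R -> R) : Prop :=
  (forall x : R, 0 < x -> is_derive x 1 u (l x)) /\
  ((u h - u 0) / h @[h --> 0^'+] --> l 0).

(* u : R_+ -> R is a utility and l its marginal utility. *)
Record is_utility (R : realType) (u l : R -> R) : Prop := IsUtility {
  utility_concave : concave_on `[0, +oo[ u ;
  utility_nondecreasing : forall x y : R, 0 <= x -> x <= y -> u x <= u y ;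
  utility_derivative : derivative_on_nonneg u l ;
  marginal_continuous : {within `[0, +oo[, continuous l} ;
  marginal_decreasing : forall x y : R, 0 <= x -> x < y -> l y < l x
}.

(* f inverts the marginal utility l : R_+ -> R at every price in [pim, pip];
   its values at other prices play no role. *)
Definition inverse_marginal (R : realType) (pim pip : R) (l f : R -> R) : Prop :=
  forall y : R, pim <= y <= pip -> 0 <= f y /\ l (f y) = y.

Definition consumption_set (R : realType) (K : nat) (lo up : 'rV[R]_K) :
    set 'rV[R]_K :=
  [set d | forall k : 'I_K, lo 0 k <= d 0 k <= up 0 k].

Definition total_utility (R : realType) (K : nat) (u : 'I_K -> R -> R)
    (d : 'rV[R]_K) : R :=
  \sum_(k < K) u k (d 0 k).

Definition net_consumption (R : realType) (K : nat) (d : 'rV[R]_K) (gi : R) : R :=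
  \sum_(k < K) d 0 k - gi.

(* pip and pim are the utility's buy and sell rates. *)
Definition nem_tariff (R : realType) (pim pip z : R) : R :=
  pip * Num.max 0 z - pim * Num.max 0 (- z).

Definition price_response (R : realType) (K : nat) (lo up : 'rV[R]_K)
    (f : 'I_K -> R -> R) (y : R) : 'rV[R]_K :=
  \row_(k < K) Num.max (lo 0 k) (Num.min (f k y) (up 0 k)).

Definition aggregate_demand (R : realType) (N K : nat) (lo up : 'I_N -> 'rV[R]_K)
    (f : 'I_N -> 'I_K -> R -> R) (y : R) : R :=
  \sum_(i < N) \sum_(k < K) price_response (lo i) (up i) (f i) y 0 k.

(* piz selects, for every level G of aggregate generation, a solution in
   [pim, pip] of fN mu = G whenever there is one.  The solution need not be
   unique, and any selection is allowed.  Solvability is not assumed. *)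
Definition balancing_price (R : realType) (pim pip : R) (fN piz : R -> R) : Prop :=
  forall G : R,
    (exists2 mu : R, pim <= mu <= pip & fN mu = G) ->
    pim <= piz G <= pip /\ fN (piz G) = G.

Definition dnem_price (R : realType) (pim pip : R) (fN piz : R -> R) (G : R) : R :=
  if G < fN pip then pip
  else if G <= fN pim then piz G
  else pim.

(* Each member is charged a single price for her net consumption. *)
Definition uniform_price_payment (R : realType) (N : nat) (price : R)
    (i : 'I_N) (z : R) : R :=
  price * z.

Definition standalone_surpluses (R : realType) (K : nat) (pim pip : R)
    (lo up : 'rV[R]_K) (u : 'I_K -> R -> R) (gi : R) : set R :=
  [set total_utility u d - nem_tariff pim pip (net_consumption d gi)
    | d in consumption_set lo up].

Definition is_max (R : realType) (S : set R) (m : R) : Prop :=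
  S m /\ ubound S m.

(* Main.v *)
Require Import Defs.
From HB Require Import structures.
From mathcomp Require Import all_boot all_order all_algebra.
From mathcomp Require Import all_classical all_reals all_analysis.
From mathcomp Require Import lra.
Import Order.TTheory GRing.Theory Num.Theory.
Import numFieldNormedType.Exports.
Local Open Scope classical_set_scope.
Local Open Scope ring_scope.

(* The D-NEM price p lies in [pim, pip] and clears the community: at the
   resulting aggregate net consumption, the linear payment at p equals the NEM
   tariff.  This is profit neutrality; in the balanced zone p exists by the
   intermediate value theorem for the continuous aggregate demand.
   For individual rationality, the tariff dominates z |-> p z for every p in
   [pim, pip], so a standalone surplus is at most the surplus of the same bundle
   under the price p, which the clamped bundle maximizes by concavity. *)

Lemma marginal_nonincreasing {R : realType} {u l : R -> R} (hu : is_utility u l)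
    {x y : R} : 0 <= x -> x <= y -> l y <= l x.
Proof.
move=> x0; rewrite le_eqVlt => /predU1P[->//|xy].
exact/ltW/(marginal_decreasing hu).
Qed.

Lemma marginal_injective {R : realType} {u l : R -> R} (hu : is_utility u l)
    {x y : R} : 0 <= x -> 0 <= y -> l x = l y -> x = y.
Proof.
move=> x0 y0 lxy; case: (ltgtP x y) => // [xy|yx].
- by have := marginal_decreasing hu x0 xy; rewrite lxy ltxx.
- by have := marginal_decreasing hu y0 yx; rewrite lxy ltxx.
Qed.

Lemma utility_continuous_pos {R : realType} {u l : R -> R} (hu : is_utility u l)
    {x : R} : 0 < x -> {for x, continuous u}.
Proof.
move=> x0; have [du _] := utility_derivative hu.
by apply: differentiable_continuous; apply/derivable1_diffP; have [] := du x x0.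
Qed.

(** The derivative at 0 is only one-sided, so continuity there comes from
    [u h = h * ((u h - u 0) / h) + u 0] as [h] tends to 0 from the right. Segments starting at 0
    rely on it. *)
Lemma utility_right_continuous0 {R : realType} {u l : R -> R}
    (hu : is_utility u l) : u h @[h --> 0^'+] --> u 0.
Proof.
have [_ d0] := utility_derivative hu.
have hid : (h : R) @[h --> (0 : R)^'+] --> (0 : R).
  by apply: cvg_at_right_filter; exact: cvg_id.
have lim : h * ((u h - u 0) / h) + u 0 @[h --> 0^'+] --> 0 * l 0 + u 0.
  by apply: cvgD; [exact: cvgM|exact: cvg_cst].
rewrite mul0r add0r in lim; apply: cvg_trans lim.
apply: near_eq_cvg; near=> h.
have h0 : h != 0 by rewrite gt_eqF//; near: h; exact: nbhs_right_gt.
by rewrite mulrC divfK// subrK.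
Unshelve. all: by end_near. Qed.

Lemma utility_continuous_segment {R : realType} {u l : R -> R}
    (hu : is_utility u l) {a b : R} :
  0 <= a -> a < b -> {within `[a, b], continuous u}.
Proof.
move=> a0 ab; have b0 := le_lt_trans a0 ab.
apply/(continuous_within_itvP u ab); split.
- move=> x; rewrite in_itv/= => /andP[ax _].
  exact/(utility_continuous_pos hu)/(le_lt_trans a0).
- move: a0; rewrite le_eqVlt => /predU1P[<-|a0].
    exact: utility_right_continuous0 hu.
  by apply: cvg_at_right_filter; exact: (utility_continuous_pos hu a0).
- by apply: cvg_at_left_filter; exact: (utility_continuous_pos hu b0).
Qed.

(** By the mean value theorem the increment has slope [l c] for some [c] strictly between [a] and
    [x]; monotonicity of [l] compares [l c] with [l a] on either side of [a]. *)
Lemma utility_tangent_bound {R : realType} {u l : R -> R} (hu : is_utility u l)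
    {a x : R} : 0 <= a -> 0 <= x -> u x - u a <= l a * (x - a).
Proof.
have mvt p q : 0 <= p -> p < q ->
    exists2 c, p < c < q & u q - u p = l c * (q - p).
  move=> p0 pq; have [du _] := utility_derivative hu.
  have duI z : z \in `]p, q[%R -> is_derive z 1 u (l z).
    by rewrite in_itv/= => /andP[pz _]; exact/du/(le_lt_trans p0).
  have [c cpq e] := MVT pq duI (utility_continuous_segment hu p0 pq).
  by exists c => //; move: cpq; rewrite in_itv.
move=> a0 x0; case: (ltgtP a x) => [ax|xa|->]; last by rewrite !subrr mulr0.
- have [c /andP[ac _] ->] := mvt _ _ a0 ax.
  rewrite ler_wpM2r ?subr_ge0 ?(ltW ax)//.
  exact: (marginal_nonincreasing hu) (ltW ac).
- have [c /andP[xc ca] e] := mvt _ _ x0 xa.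
  have lca := marginal_nonincreasing hu (le_trans x0 (ltW xc)) (ltW ca).
  have ax0 : 0 <= a - x by rewrite subr_ge0 ltW.
  by have := ler_wpM2r ax0 lca; lra.
Qed.

Lemma clamp_maximizes_surplus {R : realType} {u l : R -> R}
    (hu : is_utility u l) {lo up y fy x : R} :
  0 <= lo -> 0 <= fy -> l fy = y -> lo <= x <= up ->
  u x - y * x <= u (Num.max lo (Num.min fy up))
                 - y * Num.max lo (Num.min fy up).
Proof.
move=> lo0 fy0 lfy /andP[lox xup]; set c := Num.max _ _.
have loc : lo <= c by rewrite le_max lexx.
have c0 := le_trans lo0 loc.
have tangent := utility_tangent_bound hu c0 (le_trans lo0 lox).
(* After the tangent bound at [c], it remains to see that [y - l c] and [x - c] do not have opposite
   signs. *)
suff : l c * (x - c) <= y * (x - c) by lra.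
rewrite -subr_ge0 -mulrBl -lfy.
case: (ltgtP c fy) => [cf|fc|->]; last by rewrite subrr mul0r.
(* The clamp falls below [fy] only when the upper bound binds, so both factors are nonpositive; in
   the mirror case the lower bound binds and both are nonnegative. *)
- have cup : c = up.
    move: cf; rewrite /c; case: (leP fy up) => h; case: (leP lo _) => h1 cf; lra.
  rewrite -mulrNN mulr_ge0// oppr_ge0 subr_le0 ?cup//.
  by rewrite -cup; exact: (marginal_nonincreasing hu) (ltW cf).
- have clo : c = lo.
    move: fc; rewrite /c; case: (leP fy up) => h; case: (leP lo _) => h1 fc; lra.
  rewrite mulr_ge0// subr_ge0 ?clo//.
  by rewrite -clo; exact: (marginal_nonincreasing hu) (ltW fc).
Qed.

(** A decreasing function that takes every value between its endpoint values has no jumps. The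
    preimage of [x] is [l x], by injectivity of [l]. *)
Lemma inverse_marginal_continuous {R : realType} {u l f : R -> R} {pim pip : R} :
  pim <= pip -> is_utility u l -> inverse_marginal pim pip l f ->
  {within `[pim, pip], continuous f}.
Proof.
move=> pp hu hf.
have f0 y : y \in `[pim, pip] -> 0 <= f y by rewrite in_itv => /hf[].
have fK y : y \in `[pim, pip] -> l (f y) = y by rewrite in_itv => /hf[].
have fmono : {in `[pim, pip] &, forall x y, x < y -> f y < f x}.
  move=> x y xI yI xy; rewrite ltNge; apply/negP => fxy.
  have := marginal_nonincreasing hu (f0 _ xI) fxy.
  by rewrite !fK// leNgt xy.
apply: segment_dec_surj_continuous.
  move=> x y xI yI /=; case: (leP y x) => [|xy].
    rewrite le_eqVlt => /predU1P[->|/fmono yx]; first exact: lexx.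
    exact/ltW/yx.
  by apply/negbTE; rewrite -ltNge fmono.
move=> x /=; rewrite in_itv/= => /andP[fpx xfm].
have pimI : pim \in `[pim, pip] by rewrite in_itv/= lexx.
have pipI : pip \in `[pim, pip] by rewrite in_itv/= lexx pp.
have x0 := le_trans (f0 _ pipI) fpx.
have lxI : l x \in `[pim, pip].
  have := marginal_nonincreasing hu x0 xfm.
  have := marginal_nonincreasing hu (f0 _ pipI) fpx.
  by rewrite !fK// in_itv/= => -> ->.
by exists (l x) => //; exact: (marginal_injective hu) (f0 _ lxI) x0 (fK _ lxI).
Qed.

Lemma aggregate_demand_continuous {R : realType} {N K : nat}
    {lo up : 'I_N -> 'rV[R]_K} {u l f : 'I_N -> 'I_K -> R -> R} {pim pip : R} :
  pim <= pip -> (forall i k, is_utility (u i k) (l i k)) ->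
  (forall i k, inverse_marginal pim pip (l i k) (f i k)) ->
  {within `[pim, pip], continuous (aggregate_demand lo up f)}.
Proof.
move=> pp hu hf x.
apply: cvg_big => [|i _]; first exact: add_continuous.
apply: cvg_big => [|k _]; first exact: add_continuous.
(* The clamp is rewritten with pointwise [\max] and [\min] of functions on the subspace, so that
   continuity passes through them. *)
pose r : subspace `[pim, pip] -> R^o :=
  (fun=> lo i 0 k) \max (f i k \min (fun=> up i 0 k)).
have <- : r = fun y => price_response (lo i) (up i) (f i) y 0 k.
  by apply/funext => y; rewrite mxE.
rewrite mxE; apply: (@continuous_max _ _ _ _ x); first exact: cst_continuous.
apply: continuous_min; last exact: cst_continuous.
exact: (inverse_marginal_continuous pp (hu i k) (hf i k)).
Qed.

(** In the outer zones the sign of [D p - G] selects the branch of the tariff whose rate is [p]; in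
    the middle zone both sides vanish. *)
Lemma dnem_price_clears {R : realType} {D piz : R -> R} {pim pip : R} (G : R) :
  pim <= pip -> {within `[pim, pip], continuous D} ->
  balancing_price pim pip D piz ->
  let p := dnem_price pim pip D piz G in
  pim <= p <= pip /\ p * (D p - G) = nem_tariff pim pip (D p - G).
Proof.
move=> pp Dc hpiz; rewrite /dnem_price/=; case: (ltP G (D pip)) => [GD|DG].
  rewrite pp lexx; split=> //; rewrite /nem_tariff.
  by rewrite (@max_r _ _ 0) ?(@max_l _ _ 0); lra.
case: (leP G (D pim)) => [GD|DG'].
  (* [hpiz] constrains [piz G] only once some solution is known; the intermediate value theorem
     provides it. *)
  have [|c cI Dc_eq] := IVT (v := G) pp Dc.
    by rewrite ge_min le_max DG GD orbT.
  have [|-> ->] := hpiz G; first by exists c.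
  by split=> //; rewrite subrr /nem_tariff oppr0 maxxx !mulr0 subrr.
rewrite pp lexx; split=> //; rewrite /nem_tariff.
by rewrite (@max_l _ _ 0) ?(@max_r _ _ 0); lra.
Qed.

(** Lets the one-member community choose its own price selection. Levels without a solution receive
    the arbitrary price 0. *)
Lemma balancing_price_exists {R : realType} (D : R -> R) (pim pip : R) :
  exists piz, balancing_price pim pip D piz.
Proof.
have /choice[piz hpiz] : forall G, exists p,
    (exists2 mu : R, pim <= mu <= pip & D mu = G) -> pim <= p <= pip /\ D p = G.
  move=> G; case: (pselect (exists2 mu : R, pim <= mu <= pip & D mu = G)).
    by move=> [mu]; exists mu.
  by move=> noG; exists 0 => /noG.
by exists piz.
Qed.

(** The tariff has slope [pim] left of 0 and [pip] right of 0, so [p] is a subgradient at 0. *)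
Lemma nem_tariff_ge_linear {R : realType} (pim pip p z : R) :
  pim <= p <= pip -> p * z <= nem_tariff pim pip z.
Proof.
move=> /andP[pmp ppp]; rewrite /nem_tariff; case: (leP 0 z) => z0.
- rewrite (@max_l _ _ 0) ?oppr_le0// mulr0 subr0.
  exact: ler_wpM2r.
- rewrite (@max_r _ _ 0) ?oppr_ge0 ?(ltW z0)// mulr0 sub0r mulrN opprK.
  by rewrite ler_wnM2r// ltW.
Qed.

(** A linear payment separates over devices, and [gi] shifts both sides equally, so each device is
    an independent clamp problem. *)
Lemma price_response_maximizes_surplus {R : realType} {K : nat}
    {lo up : 'rV[R]_K} {u l f : 'I_K -> R -> R} {pim pip p : R} (gi : R)
    (d : 'rV[R]_K) :
  (forall k, 0 <= lo 0 k) ->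
  (forall k, is_utility (u k) (l k)) ->
  (forall k, inverse_marginal pim pip (l k) (f k)) ->
  pim <= p <= pip -> consumption_set lo up d ->
  total_utility u d - p * net_consumption d gi <=
  total_utility u (price_response lo up f p)
    - p * net_consumption (price_response lo up f p) gi.
Proof.
move=> lo0 hu hf hp hd; set d' := price_response _ _ _ _.
suff : total_utility u d - p * \sum_(k < K) d 0 k <=
       total_utility u d' - p * \sum_(k < K) d' 0 k.
  by rewrite /net_consumption; lra.
rewrite /total_utility !mulr_sumr -!sumrB; apply: ler_sum => k _.
rewrite mxE; have [fy0 lfy] := hf k p hp.
exact: (clamp_maximizes_surplus (hu k) (lo0 k) fy0 lfy (hd k)).
Qed.

Lemma price_response_feasible {R : realType} {K : nat} (lo up : 'rV[R]_K)
    (f : 'I_K -> R -> R) (p : R) :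
  (forall k, lo 0 k <= up 0 k) ->
  consumption_set lo up (price_response lo up f p).
Proof.
move=> hup k; rewrite mxE le_max lexx/= ge_max hup/=.
by rewrite ge_min lexx orbT.
Qed.

(* The standalone optimum is the D-NEM outcome of the one-member community:
   its price balances the tariff exactly, while the tariff dominates every
   linear payment at a price in [pim, pip]. *)
Lemma standalone_max_exists {R : realType} {K : nat}
    {lo up : 'rV[R]_K} {u l f : 'I_K -> R -> R} {pim pip : R} (gi : R) :
  (forall k, 0 <= lo 0 k) -> (forall k, lo 0 k <= up 0 k) -> pim <= pip ->
  (forall k, is_utility (u k) (l k)) ->
  (forall k, inverse_marginal pim pip (l k) (f k)) ->
  exists m, is_max (standalone_surpluses pim pip lo up u gi) m.
Proof.
move=> lo0 hup pp hu hf.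
pose D := aggregate_demand (fun _ : 'I_1 => lo) (fun=> up) (fun=> f).
have Dc : {within `[pim, pip], continuous D}.
  by apply: aggregate_demand_continuous pp _ _ => i k; [exact: hu|exact: hf].
have [piz hpiz] := balancing_price_exists D pim pip.
have [] := dnem_price_clears gi pp Dc hpiz.
set p := dnem_price _ _ _ _ _ => hp; rewrite {1 2}/D /aggregate_demand big_ord1.
rewrite -/(net_consumption (price_response lo up f p) gi) => clears.
(* The maximum is left open and becomes the surplus at the response to [p]. *)
eexists; split; first by eexists; [exact: price_response_feasible hup|].
move=> _ [d hd <-]; rewrite -clears.
apply: le_trans (price_response_maximizes_surplus gi d lo0 hu hf hp hd).
by rewrite lerD2l lerN2 nem_tariff_ge_linear.
Qed.

Theorem lemma1 (R : realType) (N K : nat)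
    (lo up : 'I_N -> 'rV[R]_K)
    (U L f : 'I_N -> 'I_K -> R -> R)
    (pim pip : R) (piz : R -> R)
    (hlo : forall (i : 'I_N) (k : 'I_K), 0 <= lo i 0 k)
    (hup : forall (i : 'I_N) (k : 'I_K), lo i 0 k <= up i 0 k)
    (hpi : 0 <= pim <= pip)
    (hU : forall (i : 'I_N) (k : 'I_K), is_utility (U i k) (L i k))
    (hf : forall (i : 'I_N) (k : 'I_K), inverse_marginal pim pip (L i k) (f i k))
    (hpiz : balancing_price pim pip (aggregate_demand lo up f) piz)
    (g : 'I_N -> R)
    (hg : forall i : 'I_N, 0 <= g i) :
  let price : R :=
    dnem_price pim pip (aggregate_demand lo up f) piz (\sum_(i < N) g i) in
  let P : 'I_N -> R -> R := @uniform_price_payment R N price in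
  let d : 'I_N -> 'rV[R]_K :=
    fun i => price_response (lo i) (up i) (f i) price in
  let z : 'I_N -> R := fun i => net_consumption (d i) (g i) in
  [/\ (forall (i j : 'I_N) (zi zj : R), i != j -> zi = zj -> P i zi = P j zj),
      (exists Pc : R -> R,
        [/\ (forall (i : 'I_N) (x : R), P i x = Pc x),
            (forall x y : R, x <= y -> Pc x <= Pc y) &
            Pc 0 = 0]),
      (forall i : 'I_N, exists2 m : R,
        is_max (standalone_surpluses pim pip (lo i) (up i) (U i) (g i)) m &
        m <= total_utility (U i) (d i) - P i (z i)) &
      \sum_(i < N) P i (z i) = nem_tariff pim pip (\sum_(i < N) z i)].
Proof.
move=> price P d z; have /andP[_ pp] := hpi.
have [hprice clears] := dnem_price_clears (\sum_(i < N) g i) pp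
  (aggregate_demand_continuous pp hU hf) hpiz.
split.
- by move=> i j zi zj _ ->.
(* Monotonicity needs a nonnegative slope, which [0 <= pim <= price] gives. *)
- exists (fun x => price * x); split=> [//|x y xy|]; last by rewrite mulr0.
  have [pim0 _] := andP hpi; have [pimp _] := andP hprice.
  exact: ler_wpM2l (le_trans pim0 pimp) _ _ xy.
- move=> i; have [m mmax] := standalone_max_exists (g i) (hlo i) (hup i) pp
    (hU i) (hf i).
  (* [m] is attained at some bundle [b]; passing from the tariff to the linear payment, and then
     from [b] to the price response, can only raise the surplus. *)
  exists m => //; have [[b hb <-] _] := mmax.
  apply: le_trans (price_response_maximizes_surplus (g i) b (hlo i) (hU i)
    (hf i) hprice hb).
  by rewrite lerD2l lerN2 nem_tariff_ge_linear.
- have zE : \sum_(i < N) z i =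
      aggregate_demand lo up f price - \sum_(i < N) g i by rewrite -sumrB.
  by rewrite -mulr_sumr zE clears.
Qed.
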